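(* Let $n\ge1$ and let $p_1,\dots,p_n\in(0,1]$. Then: (i) if $R_1\le 1$, then $$\mathcal{V}^*(p_1,\dots,p_n)\ge\frac{R_1\left(\frac{n}{n+R_1}\right)^n}{1-\left(\frac{n}{n+R_1}\right)^n}>\frac{R_1}{e^{R_1}-1}\ge\frac1{e-1};$$ (ii) if $1<R_1<\infty$, then $$\mathcal{V}^*(p_1,\dots,p_n)\ge\frac{e^{-1}}{1-\prod_{i=1}^n(1-p_i)};$$ (iii) if $R_1=\infty$, then $\mathcal{V}^*(p_1,\dots,p_n)=\mathcal{V}(p_1,\dots,p_n)$.
   Context: Last-success (standard) game: independent Bernoulli variables $I_1,\dots,I_n$ with $P(I_i=1)=p_i>0$ are observed sequentially, and the player wins if he stops on the last variable equal to $1$. Put $q_i=1-p_i$, $r_i=p_i/q_i$ (with $r_i=\infty$ if $p_i=1$), $R_k=\sum_{i=k}^n r_i\in[0,\infty]$ (empty sum $=0$). The optimal threshold is $\mathbf{s}=\max\{1\le k\le n: R_k\ge 1\}$ if $R_1\ge 1$, and $\mathbf{s}=1$ otherwise. The optimal win probability of the standard game is $$\mathcal{V}(p_1,\dots,p_n)=\Big(\prod_{j=\mathbf{s}}^n q_j\Big)\Big(\sum_{i=\mathbf{s}}^n r_i\Big)\ \text{ if } p_{\mathbf{s}}<1,\qquad \mathcal{V}(p_1,\dots,p_n)=\prod_{j=\mathbf{s}+1}^n q_j\ \text{ if } p_{\mathbf{s}}=1$$ (empty product $=1$). In Variant I, if all the variables turn out to be $0$ this is not a failure: the game is repeated as many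 times as necessary until a $1$ appears. The probability of winning Variant I using the optimal strategy is the win probability conditional on at least one $1$ appearing: $$\mathcal{V}^*(p_1,\dots,p_n)=\frac{\mathcal{V}(p_1,\dots,p_n)}{1-\prod_{i=1}^n(1-p_i)}.$$ If some $p_i=1$ the game never needs to be repeated. *)

(* Defs.v *)
From HB Require Import structures.
From mathcomp Require Import all_boot all_order all_algebra.
From mathcomp Require Import all_classical all_reals all_analysis.

Set Implicit Arguments.
Unset Strict Implicit.
Unset Printing Implicit Defensive.

Import Order.TTheory GRing.Theory Num.Theory.

Local Open Scope ring_scope.

(* The last-success game with parameters p_1, ..., p_n is given by [n : nat] and
   [p : nat -> R]; only the values [p i] with [1 <= i <= n] are ever used. *)

Definition odds (R : realType) (p : nat -> R) (i : nat) : \bar R :=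
  if p i == 1 then +oo%E else (p i / (1 - p i))%:E.

Definition odds_sum (R : realType) (n : nat) (p : nat -> R) (k : nat) : \bar R :=
  (\sum_(k <= i < n.+1) odds p i)%E.

Definition threshold (R : realType) (n : nat) (p : nat -> R) : nat :=
  if (1 <= odds_sum n p 1)%E
  then \max_(1 <= k < n.+1 | (1 <= odds_sum n p k)%E) k
  else 1%N.

(* In the branch [p s < 1] the sum [odds_sum n p s] is finite: an index [j > s]
   with [p j = 1] would satisfy [1 <= odds_sum n p j], against the maximality
   of [s].  Hence [fine] is the honest real value there. *)
Definition win_prob (R : realType) (n : nat) (p : nat -> R) : R :=
  let s := threshold n p in
  if p s < 1
  then (\prod_(s <= j < n.+1) (1 - p j)) * fine (odds_sum n p s)
  else \prod_(s.+1 <= j < n.+1) (1 - p j).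

(* Variant I: the game is repeated until some variable equals 1, so its optimal
   win probability is conditional on at least one success. *)
Definition win_prob_variantI (R : realType) (n : nat) (p : nat -> R) : R :=
  win_prob n p / (1 - \prod_(1 <= i < n.+1) (1 - p i)).

(* Main.v *)
Require Import Defs.
From HB Require Import structures.
From mathcomp Require Import all_boot all_order all_algebra.
From mathcomp Require Import ring lra.
From mathcomp Require Import all_classical all_reals all_analysis.

Import Order.TTheory GRing.Theory Num.Theory.

Local Open Scope ring_scope.

(* Since 1 - p_i = 1 / (1 + r_i), the win probability is S / P with
   S = \sum r_i and P = \prod (1 + r_i) over i >= s.  If R_1 <= 1 then s = 1 and
   the value of Variant I is R_1 / (P - 1), so AM-GM, P <= (1 + R_1 / n)^n
   < e^{R_1}, gives (i).  If R_1 > 1, write x = R_{s+1} < 1 and r = r_s >= 1 - x: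
   then P <= (1 + r) e^x, and (x + r) / (1 + r) is nondecreasing in r, hence at
   least 1 / (2 - x) >= e^{x - 1}. *)

Lemma expR_sub1_le (R : realType) (x : R) :
  0 <= x <= 1 -> expR x - 1 <= x * (expR 1 - 1).
Proof.
move=> /andP[x0 x1].
(* Convexity: the tangent of expR at x bounds expR 1 and expR 0 from below. *)
have h1 : expR x * (1 + (1 - x)) <= expR 1.
  by rewrite -[X in _ <= expR X](subrKC x) expRD ler_wpM2l ?expR_ge0 ?expR_ge1Dx.
have h0 : expR x * (1 - x) <= 1.
  by rewrite -[leRHS](expRxMexpNx_1 x) ler_wpM2l ?expR_ge0 ?expR_ge1Dx.
(* Averaged with weights [x] and [1 - x], the left sides give exactly [expR x], because x(2 - x) +
   (1 - x)^2 = 1. *)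
have : x * (expR x * (1 + (1 - x))) + (1 - x) * (expR x * (1 - x))
    <= x * expR 1 + (1 - x) * 1.
  by rewrite lerD// ler_wpM2l// subr_ge0.
lra.
Qed.

(** Strictness comes from 1 + y < e^y at y = x/n > 0, raised to the power [n]. This is the strict
    inequality of (i). *)
Lemma exp1DxVn_lt_expR (R : realType) (n : nat) (x : R) :
  (0 < n)%N -> 0 < x -> (1 + x / n%:R) ^+ n < expR x.
Proof.
move=> n0 x0; have xn : 0 < x / n%:R by rewrite divr_gt0 ?ltr0n.
rewrite -[x in ltRHS](@divfK _ n%:R) ?pnatr_eq0 -?lt0n// expRM_natr.
by rewrite ltrXn2r -?lt0n ?addr_ge0 ?ler01 ?ltW// expR_gt1Dx// gt_eqF.
Qed.

Lemma prodr_1D_le_expR (R : realType) (I : Type) (s : seq I) (P : pred I)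
    (r : I -> R) :
  (forall i, P i -> 0 <= r i) ->
  \prod_(i <- s | P i) (1 + r i) <= expR (\sum_(i <- s | P i) r i).
Proof.
move=> r0; rewrite expR_sum; apply: ler_prod => i Pi.
by rewrite addr_ge0 ?r0 ?expR_ge1Dx.
Qed.

(** AM-GM for the factors 1 + r_i, whose mean is 1 plus the mean of the r_i. *)
Lemma prodr_1D_le_AGM (R : numFieldType) (n : nat) (r : nat -> R) :
  (0 < n)%N -> (forall i, (1 <= i <= n)%N -> 0 <= r i) ->
  \prod_(1 <= i < n.+1) (1 + r i)
    <= (1 + (\sum_(1 <= i < n.+1) r i) / n%:R) ^+ n.
Proof.
move=> n0 r0; rewrite !big_add1 /= !big_mkord.
have := leif_AGM (A := 'I_n) (E := fun i : 'I_n => 1 + r i.+1).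
case=> [i _|]; first by rewrite addr_ge0 ?ler01 ?r0// ltn_ord.
rewrite card_ord big_split /= sumr_const card_ord mulrDl divff //.
by rewrite pnatr_eq0 -lt0n.
Qed.

(** Two bounds are chained: e^{x-1}(2 - x) <= 1, and 1 + r <= (x + r)(2 - x). In the second, the
    difference of the two sides factors as (1 - x)(x + r - 1). Part (ii) takes x = R_{s+1} and r =
    r_s. *)
Lemma expRN1_le_ratio (R : realType) (x r : R) :
  x <= 1 -> 1 <= x + r -> 0 <= r ->
  expR (-1) <= (x + r) / ((1 + r) * expR x).
Proof.
move=> x1 xr r0.
rewrite ler_pdivlMr; last by rewrite mulr_gt0 ?expR_gt0//; lra.
have hx : expR (-1) * expR x * (1 + (1 - x)) <= 1.
  rewrite -[leRHS](expR0 R) -(subrr (1 - x)) expRD -expRD mulrC.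
  by rewrite opprB (addrC x) ler_wpM2r ?expR_ge0 ?expR_ge1Dx.
have e0 : 0 <= expR (-1) * expR x by rewrite mulr_ge0 ?expR_ge0.
set e := expR (-1) * expR x in hx e0.
rewrite (_ : expR (-1) * _ = e * (1 + r)); last by rewrite /e; ring.
have : e * (1 + r) <= e * ((x + r) * (1 + (1 - x))).
  rewrite ler_wpM2l// -subr_ge0.
  rewrite (_ : _ - _ = (1 - x) * (x + r - 1)); last by ring.
  by rewrite mulr_ge0// subr_ge0.
have : (x + r) * (e * (1 + (1 - x))) <= (x + r) * 1 by rewrite ler_wpM2l//; lra.
lra.
Qed.

Lemma odds_sum_eqyP (R : realType) (n : nat) (p : nat -> R) (k : nat) :
  odds_sum n p k = +oo%E <-> exists2 i, (k <= i <= n)%N & p i = 1.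
Proof.
have oddsNy i : odds p i != -oo%E by rewrite /odds; case: ifP.
rewrite /odds_sum esum_eqyP//.
split=> [[i [+ _]]|[i ki pi1]].
  rewrite mem_index_iota ltnS /odds => ki; case: eqP => // pi1 _.
  by exists i.
by exists i; rewrite mem_index_iota ltnS /odds pi1 eqxx.
Qed.

Lemma odds_sum_fin (R : realType) (n : nat) (p : nat -> R) (k : nat) :
  (forall i, (k <= i <= n)%N -> p i < 1) ->
  odds_sum n p k = (\sum_(k <= i < n.+1) p i / (1 - p i))%:E.
Proof.
move=> p1; rewrite /odds_sum -sumEFin; apply: eq_big_nat => i ki.
by rewrite /odds lt_eqF ?p1.
Qed.

Lemma threshold_spec (R : realType) (n : nat) (p : nat -> R)
    (s := threshold n p) :
  (1 <= odds_sum n p 1)%E ->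
  [/\ (1 <= s <= n)%N, (1 <= odds_sum n p s)%E
    & forall k, (s < k)%N -> (odds_sum n p k < 1)%E].
Proof.
move=> h; have n0 : (0 < n)%N.
  by case: n @s h => // _; rewrite /odds_sum big_geq// lee_fin ler10.
have ub k : (1 <= k <= n)%N -> (1 <= odds_sum n p k)%E -> (k <= s)%N.
  move=> kn hk; rewrite /s /threshold h.
  by rewrite (@leq_bigmax_seq _ _ _ id)// mem_index_iota.
(* The value 0 is the default of an empty maximum; it is excluded below because k = 1 qualifies. *)
pose good k := k = 0 \/ (1 <= k <= n)%N /\ (1 <= odds_sum n p k)%E.
have : good s.
  rewrite /s /threshold h big_nat_cond; apply: big_ind; first by left.
  - by move=> x y hx hy; rewrite /maxn; case: (x < y)%N.
  - by move=> i /andP[]; rewrite ltnS; right.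
have s1 : (1 <= s)%N by exact: ub.
case=> [s0|[sn hs]]; first by rewrite s0 in s1.
(* Beyond [n] the sum is empty. This case matters when s = n, since part (ii) uses k = s + 1. *)
split=> // k sk; case: (leqP k n) => kn; last first.
  by rewrite /odds_sum big_geq// lte_fin ltr01.
rewrite ltNge; apply/negP => /ub; rewrite kn (leq_trans s1 (ltnW sk)) => /(_ isT).
by rewrite leqNgt sk.
Qed.

Lemma prodr_1B_odds (R : realType) (n : nat) (p : nat -> R) (k : nat) :
  (forall i, (k <= i <= n)%N -> p i < 1) ->
  \prod_(k <= i < n.+1) (1 - p i)
    = (\prod_(k <= i < n.+1) (1 + p i / (1 - p i)))^-1.
Proof.
move=> p1; rewrite -prodfV; apply: eq_big_nat => i ki.
have pi1 : p i < 1 by exact: p1.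
by field; apply/andP; split; lra.
Qed.

Lemma win_prob_fin (R : realType) (n : nat) (p : nat -> R)
    (r := fun i => p i / (1 - p i)) (s := threshold n p) :
  (1 <= s <= n)%N -> (forall i, (1 <= i <= n)%N -> p i < 1) ->
  win_prob n p
    = (\sum_(s <= i < n.+1) r i) / \prod_(s <= i < n.+1) (1 + r i).
Proof.
move=> sn p1; rewrite /win_prob -/s p1//.
have ps i : (s <= i <= n)%N -> p i < 1.
  by case/andP: sn => s1 _ /andP[si ni]; rewrite p1// ni (leq_trans s1).
by rewrite odds_sum_fin// prodr_1B_odds// mulrC.
Qed.

(** If s > 1, then R_1 >= r_1 + R_s >= r_1 + 1 > 1, a contradiction. Positivity of p_1 thus settles
    the boundary case R_1 = 1. *)
Lemma threshold_eq1 (R : realType) (n : nat) (p : nat -> R) :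
  (forall i, (1 <= i <= n)%N -> 0 < p i < 1) ->
  (odds_sum n p 1 <= 1)%E -> threshold n p = 1%N.
Proof.
move=> p01 R1; case: (boolP (1 <= odds_sum n p 1)%E); last first.
  by rewrite /threshold => /negbTE ->.
move=> /threshold_spec[]; set s := threshold n p => /andP[s1 sn] Rs _.
apply/eqP; rewrite eqn_leq s1 andbT leqNgt; apply/negP => lt1s.
have p1 i : (1 <= i <= n)%N -> p i < 1 by move=> /p01/andP[].
move: R1 Rs; rewrite !odds_sum_fin//; last first.
  by move=> i /andP[si ni]; rewrite p1// ni (leq_trans s1).
rewrite !lee_fin (@big_cat_nat _ _ _ s)//=; last exact: leqW.
rewrite big_ltn// => R1 Rs.
have r1 : 0 < p 1%N / (1 - p 1%N).
  have /andP[p10 p11] := p01 1%N (leq_trans s1 sn).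
  by rewrite divr_gt0// subr_gt0.
have : 0 <= \sum_(2 <= i < s) p i / (1 - p i).
  rewrite big_nat_cond sumr_ge0// => i /andP[/andP[i1 si] _].
  have /andP[pi0 pi1] : 0 < p i < 1.
    by rewrite p01// (ltnW i1) (leq_trans (ltnW si)).
  by rewrite divr_ge0 ?subr_ge0 ?ltW.
lra.
Qed.

Theorem theorem13 (R : realType) (n : nat) (p : nat -> R)
    (hn : (1 <= n)%N)
    (hp : forall i : nat, (1 <= i <= n)%N -> 0 < p i /\ p i <= 1) :
  ((odds_sum n p 1 <= 1)%E ->
     let R1 := fine (odds_sum n p 1) in
     let a := (n%:R / (n%:R + R1)) ^+ n in
     [/\ win_prob_variantI n p >= R1 * a / (1 - a),
         R1 * a / (1 - a) > R1 / (expR R1 - 1) &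
         R1 / (expR R1 - 1) >= 1 / (expR 1 - 1)])
  /\
  ((1 < odds_sum n p 1)%E -> (odds_sum n p 1 < +oo)%E ->
     win_prob_variantI n p >=
       expR (-1) / (1 - \prod_(1 <= i < n.+1) (1 - p i)))
  /\
  (odds_sum n p 1 = +oo%E -> win_prob_variantI n p = win_prob n p).
Proof.
pose r i := p i / (1 - p i).
have p01 : (odds_sum n p 1 < +oo)%E -> forall i, (1 <= i <= n)%N -> 0 < p i < 1.
  move=> R1 i ni; have [pi0 pi1] := hp i ni; rewrite pi0 lt_neqAle pi1 andbT.
  apply/eqP => pi_1; move: R1.
  by rewrite (odds_sum_eqyP _ n p 1).2 ?ltxx//; exists i.
have r_gt0 : (odds_sum n p 1 < +oo)%E -> forall i, (1 <= i <= n)%N -> 0 < r i.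
  by move=> R1 i /(p01 R1)/andP[pi0 pi1]; rewrite divr_gt0// subr_gt0.
have P_gt1 : (odds_sum n p 1 < +oo)%E -> 1 < \prod_(1 <= i < n.+1) (1 + r i).
  move=> R1; rewrite -[ltLHS](@big1_eq R 1 *%R _ (index_iota 1 n.+1) xpredT).
  by apply: ltr_prod_nat => // i ni; rewrite ler01 ltrDl r_gt0.
split; last split; last first.
(* Part (iii): some factor 1 - p_i vanishes, so the conditioning denominator is 1. *)
- move=> /odds_sum_eqyP[i ni pi1]; rewrite /win_prob_variantI.
  suff -> : \prod_(1 <= i < n.+1) (1 - p i) = 0 by rewrite subr0 divr1.
  apply/eqP; rewrite prodf_seq_eq0; apply/hasP; exists i => /=.
    by rewrite mem_index_iota.
  by rewrite pi1 subrr.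
- move=> R1gt1 R1fin.
  have p1 i : (1 <= i <= n)%N -> p i < 1 by move=> /(p01 R1fin)/andP[].
  (* Both sides of (ii) share the denominator 1 - 1/P, positive since P > 1; cancelling it leaves
     e^{-1} <= [win_prob n p]. *)
  rewrite ler_pM2r; last first.
    rewrite invr_gt0 subr_gt0 prodr_1B_odds// invf_lt1 ?P_gt1//.
    exact: lt_trans ltr01 (P_gt1 R1fin).
  have [] := threshold_spec _ _ _ (ltW R1gt1).
  set s := threshold n p => /andP[s1 sn] Rs /(_ _ (ltnSn s)) RSs.
  rewrite win_prob_fin ?s1// -/s.
  move: Rs RSs; rewrite !odds_sum_fin; last 2 first.
  + by move=> i /andP[si ni]; rewrite p1// ni (leq_trans _ si).
  + by move=> i /andP[si ni]; rewrite p1// ni (leq_trans _ si).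
  rewrite lee_fin lte_fin !(@big_ltn _ _ _ s)// (addrC (p s / _)).
  set x := \sum_(s.+1 <= i < _) _ => Rs RSs.
  have rs : 0 < r s by rewrite r_gt0// s1.
  (* It remains to replace e^x in the denominator by the smaller product of 1 + r_i over i > s. *)
  apply: le_trans (expRN1_le_ratio _ _ _ (ltW RSs) Rs (ltW rs)) _.
  have r_ge0 i : (s < i < n.+1)%N && true -> 0 <= r i.
    rewrite andbT => /andP[si ni].
    by rewrite ltW// r_gt0// (leq_trans s1 (ltnW si)).
  have P_gt0 : 0 < \prod_(s.+1 <= i < n.+1) (1 + r i).
    by rewrite big_nat_cond prodr_gt0// => i /r_ge0 ri; rewrite ltr_wpDr.
  have rs1 : 0 < 1 + r s by rewrite ltr_wpDl.
  rewrite ler_wpM2l//; first exact: le_trans ler01 Rs.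
  rewrite lef_pV2 ?posrE ?(mulr_gt0 rs1) ?expR_gt0// (ler_wpM2l (ltW rs1))//.
  rewrite /x big_nat_cond [X in expR X]big_nat_cond.
  exact: prodr_1D_le_expR.
- move=> R1le1 R1 a.
  have R1fin : (odds_sum n p 1 < +oo)%E by apply: le_lt_trans R1le1 (ltry _).
  have p1 i : (1 <= i <= n)%N -> p i < 1 by move=> /(p01 R1fin)/andP[].
  have R1E : R1 = \sum_(1 <= i < n.+1) r i by rewrite /R1 odds_sum_fin.
  have R1_le1 : R1 <= 1 by rewrite R1E -lee_fin -odds_sum_fin.
  have R1_gt0 : 0 < R1.
    rewrite R1E big_ltn// ltr_pwDl ?r_gt0// big_nat_cond sumr_ge0// => i.
    rewrite andbT => /andP[i1 ni]; rewrite ltW// r_gt0//.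
    by rewrite (ltnW i1).
  have nE : n%:R != 0 :> R by rewrite pnatr_eq0 -lt0n.
  have n_gt0 : 0 < n%:R :> R by rewrite ltr0n.
  (* Since a = 1/A, the first three terms of the chain all have the form R_1 / (y - 1), with y equal
     to P, A and e^{R_1}. They compare through 1 < P <= A < e^{R_1}. *)
  pose A := (1 + R1 / n%:R) ^+ n.
  have aE : a = A^-1.
    rewrite /a /A -exprVn; congr (_ ^+ _); field.
    by rewrite nE/= gt_eqF// addr_gt0.
  have AltE : A < expR R1 by exact: exp1DxVn_lt_expR.
  have PleA : \prod_(1 <= i < n.+1) (1 + r i) <= A.
    by rewrite /A R1E; apply: prodr_1D_le_AGM => // i ni; rewrite ltW// r_gt0.
  have P1 := P_gt1 R1fin.
  have A1 : 1 < A by exact: lt_le_trans PleA.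
  have divV1B (x : R) : 1 < x -> R1 / x / (1 - x^-1) = R1 / (x - 1).
    move=> x1; field.
    by rewrite gt_eqF ?subr_gt0// gt_eqF// (lt_trans ltr01).
  rewrite aE divV1B//; split.
  + have s1 : threshold n p = 1%N by apply: threshold_eq1 => //; exact: p01.
    rewrite /win_prob_variantI win_prob_fin ?s1 ?hn// prodr_1B_odds// -R1E divV1B//.
    by rewrite ler_pM2l// lef_pV2 ?posrE ?subr_gt0// lerB.
  + rewrite ltr_pM2l// ltf_pV2 ?posrE ?subr_gt0 ?expR_gt1// ltrD2r.
    exact: AltE.
  + have E1 : 1 < expR 1 :> R by rewrite expR_gt1.
    (* Cross-multiplied, this is the chord bound for the convex [expR] on [0, 1], taken at R_1. *)
    rewrite ler_pdivlMr ?subr_gt0 ?expR_gt1// mulrAC mul1r.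
    rewrite ler_pdivrMr ?subr_gt0//; apply: expR_sub1_le.
    by rewrite (ltW R1_gt0) R1_le1.
Qed.
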